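(* Having fenced infinite intersections is a quasi-isometry invariant of group pairs: if $(G,\mathcal{P})$ and $(H,\mathcal{Q})$ are quasi-isometric group pairs, then $(G,\mathcal{P})$ has fenced infinite intersections if and only if $(H,\mathcal{Q})$ has fenced infinite intersections.
   Context: A group pair $(G,\mathcal{P})$ is a finitely generated group $G$ together with a finite collection $\mathcal{P}$ of infinite subgroups of $G$. $G$ carries a fixed word metric $\mathrm{dist}_G$ with respect to a finite generating set; $\mathrm{dist}_G(A,B)$ is the infimum distance between subsets and $\mathrm{hdist}_G$ the Hausdorff distance. $G/\mathcal{P}$ is the set of all left cosets $gP$, $g\in G$, $P\in\mathcal{P}$. $(G,\mathcal{P})$ and $(H,\mathcal{Q})$ are quasi-isometric if there are a quasi-isometry $q\colon G\to H$ and $M>0$ such that for every $A\in G/\mathcal{P}$ there is $B\in H/\mathcal{Q}$ with $\mathrm{hdist}_H(q(A),B)<M$, and for every $B\in H/\mathcal{Q}$ there is $A\in G/\mathcal{P}$ with $\mathrm{hdist}_H(q(A),B)<M$. $(G,\mathcal{P})$ has fenced infinite intersections if there is $\tau\ge0$ such that for any $g_1P_1,g_2P_2\in G/\mathcal{P}$ with $g_1P_1g_1^{-1}\cap g_2P_2g_2^{-1}$ infinite, $\mathrm{dist}_G(g_1P_1,g_2P_2)\le\tau$. *)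

(* Defs.v *)
From mathcomp Require Import all_boot all_order all_algebra.
From mathcomp Require Import all_classical all_reals ereal.

Set Implicit Arguments.
Unset Strict Implicit.
Unset Printing Implicit Defensive.

Import Order.TTheory GRing.Theory Num.Theory.

Local Open Scope classical_set_scope.
Local Open Scope ring_scope.

Section WordMetric.
Variable G : groupType.

Definition is_word (S w : seq G) : bool :=
  all (fun x => (x \in S) || ((x^-1)%g \in S)) w.

(* A finite generating set, given by an enumeration of it. *)
Record genset := Genset {
  gens :> seq G;
  gensP : forall g : G,
    exists w : seq G, is_word gens w /\ (\prod_(x <- w) x)%g = g }.

Definition spelled_in (S : genset) (g : G) (n : nat) : bool :=
  `[< exists w : seq G,
        [/\ is_word S w, (\prod_(x <- w) x)%g = g & size w = n] >].

Lemma spelled_in_ex (S : genset) (g : G) : exists n, spelled_in S g n.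
Proof.
by have [w [Sw wg]] := gensP S g; exists (size w); apply/asboolP; exists w.
Qed.

Definition word_length (S : genset) (g : G) : nat :=
  ex_minn (spelled_in_ex S g).

(* The left-invariant word metric, as cosets below are left cosets. *)
Definition word_dist (S : genset) (x y : G) : nat :=
  word_length S (x^-1 * y)%g.

Definition lcoset_set (g : G) (P : set G) : set G := [set (g * x)%g | x in P].

Definition conj_set (g : G) (P : set G) : set G :=
  [set (g * x * g^-1)%g | x in P].

End WordMetric.

(* A group pair on G, together with the finite generating set that defines the
   fixed word metric of G.  The collection may be empty. *)
Record group_pair (G : groupType) := GroupPair {
  gp_gens : genset G;
  gp_coll : set (set G);
  gp_finite : finite_set gp_coll;
  gp_subgroup : forall P, gp_coll P -> group_closed [in P];
  gp_infinite : forall P, gp_coll P -> infinite_set P }.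

Definition gp_dist (G : groupType) (GP : group_pair G) : G -> G -> nat :=
  word_dist (gp_gens GP).

(* The set G/P of all left cosets of members of the collection. *)
Definition gp_cosets (G : groupType) (GP : group_pair G) : set (set G) :=
  [set A | exists g P, gp_coll GP P /\ A = lcoset_set g P].

Section Coarse.
Variable R : realType.

Definition set_dist (T : Type) (d : T -> T -> nat) (A B : set T) : \bar R :=
  ereal_inf [set ((d a b)%:R)%:E | a in A & b in B].

Definition nbhd_set (T : Type) (d : T -> T -> nat) (r : R) (A : set T) :
  set T := [set x | exists2 a, A a & (d x a)%:R <= r].

(* Takes the value +oo when no r is admissible. *)
Definition hdist (T : Type) (d : T -> T -> nat) (A B : set T) : \bar R :=
  ereal_inf [set r%:E | r in [set r : R |
    [/\ 0 <= r, A `<=` nbhd_set d r B & B `<=` nbhd_set d r A]]].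

Definition quasi_isometry (T U : Type) (dT : T -> T -> nat)
    (dU : U -> U -> nat) (q : T -> U) : Prop :=
  exists L C : R, [/\ 1 <= L, 0 <= C,
    forall x y, L^-1 * (dT x y)%:R - C <= (dU (q x) (q y))%:R
                /\ (dU (q x) (q y))%:R <= L * (dT x y)%:R + C &
    forall u, exists x, (dU u (q x))%:R <= C].

Definition quasi_isometric_pairs (G H : groupType)
    (GP : group_pair G) (HQ : group_pair H) : Prop :=
  exists (q : G -> H) (M : R),
    [/\ quasi_isometry (gp_dist GP) (gp_dist HQ) q, 0 < M,
      forall A, gp_cosets GP A ->
        exists2 B, gp_cosets HQ B
                 & (hdist (gp_dist HQ) (q @` A) B < M%:E)%E &
      forall B, gp_cosets HQ B ->
        exists2 A, gp_cosets GP A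
                 & (hdist (gp_dist HQ) (q @` A) B < M%:E)%E].

Definition fenced_infinite_intersections (G : groupType)
    (GP : group_pair G) : Prop :=
  exists2 tau : R, 0 <= tau &
    forall (g1 g2 : G) (P1 P2 : set G), gp_coll GP P1 -> gp_coll GP P2 ->
      infinite_set (conj_set g1 P1 `&` conj_set g2 P2) ->
      (set_dist (gp_dist GP) (lcoset_set g1 P1) (lcoset_set g2 P2)
         <= tau%:E)%E.

End Coarse.

(* Main.v *)
Require Import Defs.
From mathcomp Require Import all_boot all_order all_algebra.
From mathcomp Require Import all_classical all_reals.
From mathcomp Require Import ereal lra.

(** Two cosets [aP] and [bQ] have conjugates with infinite intersection if and
    only if, for some [n], infinitely many points of [aP] lie at distance at
    most [n] from [bQ]: translating [a] and [b] by the intersection gives such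
    points, and conversely, balls being finite, infinitely many [x] in [aP]
    satisfy [x v] in [bQ] for one and the same [v], so that the quotients of
    any two of them lie in both conjugates.  This coarse condition, and the
    distance between two cosets, are transported up to constants by the
    relation "[q x] is at distance at most [M] from [u]", whose two directions
    play the same role. *)

Set Implicit Arguments.
Unset Strict Implicit.
Unset Printing Implicit Defensive.

Import Order.TTheory GRing.Theory Num.Theory.

Local Open Scope classical_set_scope.

(** * Word metrics: triangle inequality, left invariance, finite balls *)

Section WordMetricTheory.
Variables (G : groupType) (S : genset G).
Implicit Types (g x y z : G) (w : seq G).

Lemma word_lengthP g :
  exists w,
    [/\ is_word S w, (\prod_(x <- w) x)%g = g & size w = word_length S g].
Proof. by rewrite /word_length; case: ex_minnP => n /asboolP. Qed.

Lemma word_length_prod w :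
  is_word S w -> (word_length S (\prod_(x <- w) x)%g <= size w)%N.
Proof.
move=> Sw; rewrite /word_length; case: ex_minnP => n _; apply.
by apply/asboolP; exists w.
Qed.

Lemma word_lengthM x y :
  (word_length S (x * y)%g <= word_length S x + word_length S y)%N.
Proof.
have [v [Sv vx <-]] := word_lengthP x; have [w [Sw wy <-]] := word_lengthP y.
rewrite -size_cat -vx -wy -big_cat; apply: word_length_prod.
by rewrite /is_word all_cat; apply/andP.
Qed.

Lemma prodg_rev_inv w :
  (\prod_(x <- rev [seq x^-1 | x <- w]) x = (\prod_(x <- w) x)^-1)%g.
Proof.
elim: w => [|x w IHw]; first by rewrite !big_nil invg1.
by rewrite map_cons rev_cons -cats1 big_cat big_seq1 IHw big_cons invgM.
Qed.

Lemma word_lengthV_le x : (word_length S x^-1%g <= word_length S x)%N.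
Proof.
have [w [Sw <- <-]] := word_lengthP x.
have -> : size w = size (rev [seq y^-1 | y <- w])%g.
  by rewrite size_rev size_map.
rewrite -prodg_rev_inv; apply: word_length_prod.
rewrite /is_word all_rev all_map; apply: sub_all Sw => y /=.
by rewrite invgK orbC.
Qed.

Lemma word_distC x y : word_dist S x y = word_dist S y x.
Proof.
suff le u v : (word_dist S u v <= word_dist S v u)%N.
  by apply/eqP; rewrite eqn_leq !le.
by rewrite /word_dist -[(u^-1 * v)%g]invgK invgM invgK word_lengthV_le.
Qed.

Lemma word_dist_triangle y x z :
  (word_dist S x z <= word_dist S x y + word_dist S y z)%N.
Proof.
rewrite /word_dist (_ : (x^-1 * z)%g = (x^-1 * y * (y^-1 * z))%g).
  exact: word_lengthM.
by rewrite -mulgA mulVKg.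
Qed.

Lemma word_distMl g x y : word_dist S (g * x)%g (g * y)%g = word_dist S x y.
Proof. by rewrite /word_dist invgM -mulgA mulKg. Qed.

(** Words of length [k.+1] spell products of a letter from the finite set [T] and an element of
    [B k], so each [B k] is finite by induction; the ball is covered by [B 0], ..., [B n]. *)
Lemma finite_word_ball n : finite_set [set g | (word_length S g <= n)%N].
Proof.
pose T := [set` (S : seq G)] `|` [set x^-1%g | x in [set` (S : seq G)]].
have finT : finite_set T.
  by rewrite finite_setU; split=> //; exact: finite_image.
pose B k := [set g |
  exists w, [/\ is_word S w, (\prod_(x <- w) x)%g = g & size w = k]].
have finB k : finite_set (B k).
  elim: k => [|k IHk].
    apply: (sub_finite_set (B := [set 1%g])) => // g [w [_ <- /size0nil ->]].
    by rewrite big_nil.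
  apply: sub_finite_set (finite_image2 (fun x y => (x * y)%g) finT IHk).
  move=> g [[[]|x w [/andP[Sx Sw] <- [wk]]]] //.
  exists x; last by exists (\prod_(y <- w) y)%g; [exists w | rewrite big_cons].
  have [?|Sx'] := orP Sx; first by left.
  by right; exists x^-1%g => //; rewrite invgK.
apply: (@sub_finite_set _ _ (\bigcup_(k in `I_n.+1) B k)).
  by move=> g gn; exists (word_length S g) => //; exact: word_lengthP.
by apply: bigcup_finite => //; exact: finite_II.
Qed.

Lemma finite_word_dist_ball x n : finite_set [set y | (word_dist S x y <= n)%N].
Proof.
apply: sub_finite_set (finite_image (fun g => (x * g)%g) (finite_word_ball n)).
by move=> y xy; exists (x^-1 * y)%g => //; rewrite mulVKg.
Qed.

End WordMetricTheory.

(** * Infinite intersections of conjugates seen through nearby points of cosets *)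

Section CosetIntersections.
Variables (G : groupType) (S : genset G).
Implicit Types (a b g k x y : G) (P Q : set G).

Lemma conj_set_lcoset a P k : conj_set a P k -> lcoset_set a P (k * a)%g.
Proof. by move=> [p Pp <-]; exists p => //; rewrite mulgVK. Qed.

Lemma lcoset_set_conj a P x y : group_closed [in P] ->
  lcoset_set a P x -> lcoset_set a P y -> conj_set a P (x * y^-1)%g.
Proof.
move=> [_ PB] [p Pp <-] [r Pr <-]; exists (p * r^-1)%g.
  by apply/set_mem/PB; exact/mem_set.
by rewrite invgM !mulgA.
Qed.

Definition close_points (d : G -> G -> nat) n (A B : set G) : set G :=
  [set x | A x /\ exists2 y, B y & (d x y <= n)%N].

Lemma infinite_conj_setI a b P Q n :
  group_closed [in P] -> group_closed [in Q] ->
  infinite_set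
    (close_points (word_dist S) n (lcoset_set a P) (lcoset_set b Q)) ->
  infinite_set (conj_set a P `&` conj_set b Q).
Proof.
move=> sP sQ; apply: contra_not => finI.
pose X v := [set x | lcoset_set a P x /\ lcoset_set b Q (x * v)%g].
apply: (@sub_finite_set _ _
  (\bigcup_(v in [set v | (word_length S v <= n)%N]) X v)).
  move=> x [Px [y Qy xy]]; exists (x^-1 * y)%g => //.
  by split=> //; rewrite mulVKg.
apply: bigcup_finite => [|v _]; first exact: finite_word_ball.
(* With a base point [x0] fixed, [x * x0^-1] equals [(x * v) * (x0 * v)^-1], hence lies in both
   conjugates; so [X v] is contained in a right translate of their finite intersection. *)
have [->|/set0P[x0 [Px0 Qx0]]] := eqVneq (X v) set0; first exact: finite_set0.
apply: sub_finite_set (finite_image (fun k => (k * x0)%g) finI).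
move=> x [Px Qx]; exists (x * x0^-1)%g; last by rewrite mulgVK.
split; first exact: lcoset_set_conj.
have := lcoset_set_conj sQ Qx Qx0.
by rewrite invgM -mulgA mulVKg.
Qed.

End CosetIntersections.

(** * From infima to actual points *)

Section SetDistance.
Variables (R : realType) (T : Type) (d : T -> T -> nat).
Local Open Scope ring_scope.

(** The gap between [r] and [n] makes the bound on the infimum strict, so an actual pair of points
    realises it. *)
Lemma set_dist_le_exists (A B : set T) (r : R) n : r < n%:R ->
  (set_dist R d A B <= r%:E)%E -> exists a b, [/\ A a, B b & (d a b <= n)%N].
Proof.
move=> rn dAB; have : (set_dist R d A B < n%:R%:E)%E.
  by apply: le_lt_trans dAB _; rewrite lte_fin.
move=> /ereal_inf_lt[_ [a Aa [b Bb <-]]]; rewrite lte_fin ltr_nat => /ltnW.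
by exists a, b.
Qed.

Lemma set_dist_le (A B : set T) a b n :
  A a -> B b -> (d a b <= n)%N -> (set_dist R d A B <= n%:R%:E)%E.
Proof.
move=> Aa Bb abn; apply: (@le_trans _ _ (d a b)%:R%:E).
  by apply: ereal_inf_lbound; exists a => //; exists b.
by rewrite lee_fin ler_nat.
Qed.

Lemma hdist_lt (A B : set T) (M : R) : (hdist R d A B < M%:E)%E ->
  A `<=` nbhd_set d M B /\ B `<=` nbhd_set d M A.
Proof.
move=> /ereal_inf_lt[_ [r [_ AB BA] <-]]; rewrite lte_fin => /ltW rM.
by split=> [x /AB|x /BA] [y ? xy]; exists y => //; exact: le_trans rM.
Qed.

End SetDistance.

(** A relation replaces the map so that its converse is an object of the same kind, and one transfer
    lemma serves both directions. *)
Definition coarsely_lipschitz (T U : Type) (dT : T -> T -> nat)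
    (dU : U -> U -> nat) (E : T -> U -> Prop) : Prop :=
  exists f : nat -> nat, forall x y u v n,
    E x u -> E y v -> (dT x y <= n)%N -> (dU u v <= f n)%N.

Definition corresponding (T U : Type) (E : T -> U -> Prop)
    (A : set T) (B : set U) : Prop :=
  (forall a, A a -> exists2 b, B b & E a b) /\
  (forall b, B b -> exists2 a, A a & E a b).

(** * Transfer along a coarse correspondence *)

Section CoarseInvariance.
Variables (R : realType) (G H : groupType).
Variables (GP : group_pair G) (HQ : group_pair H).

Lemma fenced_infinite_intersections_coarse (E : G -> H -> Prop) :
  coarsely_lipschitz (gp_dist GP) (gp_dist HQ) E ->
  coarsely_lipschitz (gp_dist HQ) (gp_dist GP) (fun u x => E x u) ->
  (forall A, gp_cosets GP A -> exists2 B, gp_cosets HQ B & corresponding E A B) ->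
  fenced_infinite_intersections R HQ -> fenced_infinite_intersections R GP.
Proof.
move=> [f Ef] [f' Ef'] cosE [tau tau_ge0 fenced].
(* As [n] exceeds [tau], the fenced cosets of [H] contain points within [n] of each other, and [f']
   carries this bound back to [G]. *)
set n := Num.bound tau; exists (f' n)%:R%R => [//|a b P1 P2 PP1 PP2 infK].
have [|_ [c [Q1 [QQ1 ->]]] [EA1 EB1]] := cosE (lcoset_set a P1).
  by exists a, P1.
have [|_ [e [Q2 [QQ2 ->]]] [EA2 EB2]] := cosE (lcoset_set b P2).
  by exists b, P2.
suff infI : infinite_set (conj_set c Q1 `&` conj_set e Q2).
  have [u [v [Bu Bv uv]]] := set_dist_le_exists (archi_boundP tau_ge0)
    (fenced _ _ _ _ QQ1 QQ2 infI).
  have [x Ax Exu] := EB1 _ Bu; have [y Ay Eyv] := EB2 _ Bv.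
  exact: set_dist_le Ax Ay (Ef' _ _ _ _ _ Exu Eyv uv).
(* For [k] in both conjugates, [k * a] and [k * b] lie in the two cosets at distance
   [gp_dist GP a b] by left invariance, so their partners in [H] are within [m]. *)
pose m := f (gp_dist GP a b).
apply: (@infinite_conj_setI _ (gp_gens HQ) _ _ _ _ m);
  [exact: gp_subgroup QQ1 | exact: gp_subgroup QQ2 | ].
apply: contra_not infK; set U := close_points _ _ _ _ => finU.
pose K u := [set k : G | E (k * a)%g u].
apply: (@sub_finite_set _ _ (\bigcup_(u in U) K u)).
  move=> k [/conj_set_lcoset/EA1[u Bu Eu] /conj_set_lcoset/EA2[v Bv Ev]].
  exists u => //; split=> //; exists v => //.
  by apply: Ef Eu Ev _; rewrite /gp_dist word_distMl.
apply: bigcup_finite => // u _.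
(* All [k * a] related to the same [u] lie in one ball around [k0 * a], so only finitely many [k]
   share a partner. *)
have [->|/set0P[k0 Ek0]] := eqVneq (K u) set0; first exact: finite_set0.
apply: sub_finite_set (finite_image (fun y => (y * a^-1)%g)
  (finite_word_dist_ball (gp_gens GP) (k0 * a)%g (f' (gp_dist HQ u u)))).
by move=> k Ek; exists (k * a)%g; [exact: Ef' Ek0 Ek _ | rewrite mulgK].
Qed.

End CoarseInvariance.

(** * The correspondence induced by a quasi-isometry *)

Section QuasiIsometry.
Variables (R : realType) (G H : groupType).
Variables (GP : group_pair G) (HQ : group_pair H) (q : G -> H) (M : R).
Local Open Scope ring_scope.

Definition near_image (x : G) (u : H) : Prop := (gp_dist HQ (q x) u)%:R <= M.

Lemma gp_dist_triangle (u v w : H) :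
  (gp_dist HQ u w)%:R <= (gp_dist HQ u v)%:R + (gp_dist HQ v w)%:R :> R.
Proof. by rewrite -natrD ler_nat word_dist_triangle. Qed.

Lemma near_image_dist x y u v : near_image x u -> near_image y v ->
  (gp_dist HQ u v)%:R <= (gp_dist HQ (q x) (q y))%:R + 2 * M /\
  (gp_dist HQ (q x) (q y))%:R <= (gp_dist HQ u v)%:R + 2 * M.
Proof.
rewrite /near_image => xu yv.
have ux : (gp_dist HQ u (q x))%:R <= M by rewrite /gp_dist word_distC.
have vy : (gp_dist HQ v (q y))%:R <= M by rewrite /gp_dist word_distC.
have := gp_dist_triangle u (q x) v; have := gp_dist_triangle (q x) (q y) v.
have := gp_dist_triangle (q x) u (q y); have := gp_dist_triangle u v (q y).
by move=> *; split; lra.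
Qed.

Lemma near_image_lipschitz :
  quasi_isometry R (gp_dist GP) (gp_dist HQ) q ->
  coarsely_lipschitz (gp_dist GP) (gp_dist HQ) near_image /\
  coarsely_lipschitz (gp_dist HQ) (gp_dist GP) (fun u x => near_image x u).
Proof.
move=> [L [C [L1 C0 qLC _]]]; have L0 : 0 < L by lra.
split.
  (* The upper quasi-isometry bound, plus [M] for moving each endpoint from the image of [q] to its
     partner. *)
  exists (fun n => Num.bound (L * n%:R + C + 2 * M)) => x y u v n xu yv xyn.
  have [le_uv _] := near_image_dist xu yv; have [_ q_le] := qLC x y.
  have : L * (gp_dist GP x y)%:R <= L * n%:R by rewrite ler_pM2l // ler_nat.
  move=> le_n; rewrite -(ler_nat R) ltW //.
  by apply: le_lt_trans (unstable.ltr_bound _); lra.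
(* This solves the lower bound [L^-1 * d - C <= n + 2 * M] for [d]. *)
exists (fun n => Num.bound (L * (n%:R + 2 * M + C))) => u v x y n xu yv uvn.
have [_ le_q] := near_image_dist xu yv; have [q_ge _] := qLC x y.
have : (gp_dist HQ u v)%:R <= n%:R :> R by rewrite ler_nat.
move=> le_n; rewrite -(ler_nat R) ltW //.
apply: le_lt_trans (unstable.ltr_bound _); rewrite -ler_pdivrMl //; lra.
Qed.

Lemma corresponding_near_image (A : set G) (B : set H) :
  (hdist R (gp_dist HQ) (q @` A) B < M%:E)%E -> corresponding near_image A B.
Proof.
move=> /hdist_lt[AB BA]; split=> [a Aa|b /BA[_ [a Aa <-] ba]].
  by have [|b Bb ab] := AB (q a); [exists a | exists b].
by exists a => //; rewrite /near_image /gp_dist word_distC.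
Qed.

End QuasiIsometry.

Theorem theorem5p27 (R : realType) (G H : groupType)
    (GP : group_pair G) (HQ : group_pair H) :
  quasi_isometric_pairs R GP HQ ->
  (fenced_infinite_intersections R GP <-> fenced_infinite_intersections R HQ).
Proof.
move=> [q [M [/(near_image_lipschitz M)[lipE lipE'] _ qGH qHG]]]; split.
  (* Here the transfer lemma is applied to the converse relation, with [G] and [H] exchanged. *)
  apply: fenced_infinite_intersections_coarse lipE' lipE _ => B.
  by move=> /qHG[A PA /corresponding_near_image[EA EB]]; exists A.
apply: fenced_infinite_intersections_coarse lipE lipE' _ => A.
by move=> /qGH[B QB /corresponding_near_image AB]; exists B.
Qed.
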